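(* Let $k,\ell,n$ be positive integers with $k+\ell-3\le n<(k-1)(\ell-1)$. Then $s^{(tr)}_n(k,\ell)<s^{(tr)}_{n+1}(k,\ell)$, where $s^{(tr)}_m(k,\ell)$ denotes the number of $(k,\ell)$-top-right-crucial permutations of length $m$.
   Context: $i_m=12\cdots m$ and $d_m=m(m-1)\cdots 1$; a permutation (in one-line notation) contains $i_m$ (resp. $d_m$) if it has an increasing (resp. decreasing) subsequence of length $m$, and avoids it otherwise. The extensions of a permutation $\sigma=\sigma_1\cdots\sigma_n$ of $\{1,\ldots,n\}$ to the right are $e_t(\sigma_1)\cdots e_t(\sigma_n)\,t$, $1\le t\le n+1$, where $e_t(x)=x$ if $x<t$ and $e_t(x)=x+1$ if $x\ge t$. The extensions of $\sigma$ from above are $\sigma_1\cdots\sigma_{t-1}(n+1)\sigma_t\cdots\sigma_n$, $1\le t\le n+1$. A permutation is $(k,\ell)$-top-right-crucial if it avoids $i_k$ and $d_\ell$ but each of its extensions to the right and each of its extensions from above contains $i_k$ or $d_\ell$. *)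

(* Defs.v *)
From mathcomp Require Import all_boot all_order all_fingroup.

Set Implicit Arguments.
Unset Strict Implicit.
Unset Printing Implicit Defensive.

(* A permutation of {1, ..., n} in one-line notation is
   represented by s : 'S_n, positions and values both being shifted to
   {0, ..., n - 1}.  A subsequence is given by its set A of positions. *)

Definition contains_inc (n m : nat) (s : 'S_n) : bool :=
  [exists A : {set 'I_n},
     (#|A| == m) && [forall i in A, forall j in A, (i < j) ==> (s i < s j)]].

Definition contains_dec (n m : nat) (s : 'S_n) : bool :=
  [exists A : {set 'I_n},
     (#|A| == m) && [forall i in A, forall j in A, (i < j) ==> (s j < s i)]].

Definition contains_either (k l n : nat) (s : 'S_n) : bool :=
  contains_inc k s || contains_dec l s.

(* lift_perm p v s sends position p to value v and position lift p i to value
   lift v (s i), where lift v x is x if x < v and x + 1 if v <= x.  Hence, with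
   p = ord_max, the value v is appended and lift v is the relabelling e_v. *)
Definition right_extension (n : nat) (s : 'S_n) (t : 'I_n.+1) : 'S_n.+1 :=
  lift_perm ord_max t s.

(* Here lift ord_max leaves all values unchanged, and the new largest value is
   inserted at position t. *)
Definition above_extension (n : nat) (s : 'S_n) (t : 'I_n.+1) : 'S_n.+1 :=
  lift_perm t ord_max s.

Definition top_right_crucial (k l n : nat) (s : 'S_n) : bool :=
  [&& ~~ contains_inc k s, ~~ contains_dec l s,
      [forall t, contains_either k l (right_extension s t)]
    & [forall t, contains_either k l (above_extension s t)]].

Definition num_top_right_crucial (n k l : nat) : nat :=
  #|[set s : 'S_n | top_right_crucial k l s]|.

(* Main.v *)
Require Import Defs.
From mathcomp Require Import all_boot all_order all_fingroup.
From mathcomp Require Import zify.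

(** The proof goes through the Robinson-Schensted correspondence, which sends a
    permutation s to a pair (P, Q) of standard tableaux of the same shape.  A
    standard tableau is written as its Yamanouchi word, whose v-th letter is the
    row, counted from 1, of the v-th entry.  In this notation row insertion is
    a single left-to-right scan of the word: put a letter 0 at the place of the
    new entry, and then raise the first 0, the first 1 after it, the first 2
    after that, and so on ([slide]).

    The point of the notation is that the two kinds of extension become the
    same operation on words.  Extending s to the right at t inserts t into P
    and appends the row of the new box to Q; extending s from above at t
    inserts t into Q and appends the row of the new box to P ([rsk_right],
    [rsk_above]).  By Schensted's theorem s contains an increasing pattern of
    length k, or a decreasing one of length l, exactly when the shape has k
    columns or l rows ([contains_either_rsk]).  Hence s is top-right-crucial if
    and only if P and Q both satisfy one condition on a single tableau, called
    [crucial] below ([top_right_crucial_rsk]), and the number of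
    top-right-crucial permutations of length n is the sum, over the shapes of
    size n, of the squared number of crucial tableaux of that shape.

    Adding a new largest entry to a crucial tableau keeps it crucial, as long as
    the shape stays inside the rectangle with l - 1 rows and k - 1 columns
    ([crucial_rcons]).  When n < (k - 1) * (l - 1) the rectangle has a free box,
    so one may add a new largest entry to P and to Q in the same box; since the
    old pair is recovered by deleting the largest entries, this injects the
    top-right-crucial permutations of length n into those of length n + 1.

    The injection misses a permutation.  Take P = Q to be a tableau whose
    largest l - 1 entries sit at the ends of its l - 1 rows, in increasing
    order downwards ([hooked_word]).  Such a tableau exists because
    k + l - 3 <= n, and it is crucial, but deleting its largest entry leaves a
    tableau that is not. *)

Set Implicit Arguments.
Unset Strict Implicit.
Unset Printing Implicit Defensive.

(** * Row insertion on words *)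

(** The scan meets the entries of the tableau in increasing order while an entry
    is waiting to enter row r.  The first entry met in row r is the one that it
    bumps, and this one then waits for row r + 1. *)
Fixpoint slide (r : nat) (s : seq nat) : seq nat :=
  if s is a :: s' then
    if a == r then r.+1 :: slide r.+1 s' else a :: slide r s'
  else [::].

Fixpoint landing (r : nat) (s : seq nat) : nat :=
  if s is a :: s' then landing (if a == r then r.+1 else r) s' else r.

Definition splice (w : seq nat) (t : nat) : seq nat :=
  take t w ++ 0 :: drop t w.

Lemma notin_take (x : nat) j (w : seq nat) : x \notin w -> x \notin take j w.
Proof. by apply: contra => /mem_take. Qed.

Lemma notin_drop (x : nat) j (w : seq nat) : x \notin w -> x \notin drop j w.
Proof. by apply: contra => /mem_drop. Qed.

(** The new entry is treated as bumped out of a fictitious row 0, which makes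
    the whole insertion a single slide. *)
Definition insert (w : seq nat) (t : nat) : seq nat := slide 0 (splice w t).
Definition new_row (w : seq nat) (t : nat) : nat := landing 0 (splice w t).

Lemma size_slide r s : size (slide r s) = size s.
Proof. by elim: s r => //= a s IH r; case: eqP => _ /=; rewrite IH. Qed.

Lemma slide_cat r s1 s2 :
  slide r (s1 ++ s2) = slide r s1 ++ slide (landing r s1) s2.
Proof. by elim: s1 r => //= a s IH r; case: eqP => _ /=; rewrite IH. Qed.

Lemma landing_cat r s1 s2 : landing r (s1 ++ s2) = landing (landing r s1) s2.
Proof. by elim: s1 r => //=. Qed.

Lemma take_slide j r s : take j (slide r s) = slide r (take j s).
Proof.
by elim: s r j => [|a s IH] r [|j] //=; case: eqP => _ //=; rewrite IH.
Qed.

Lemma drop_slide j r s :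
  drop j (slide r s) = slide (landing r (take j s)) (drop j s).
Proof.
elim: s r j => [|a s IH] r [|j] //=; first by case: eqP => _ /=.
by case: eqP => _ /=; rewrite IH.
Qed.

Lemma slide_id r (s : seq nat) : r \notin s -> slide r s = s /\ landing r s = r.
Proof.
elim: s => //= a s IH; rewrite inE negb_or eq_sym => /andP[/negbTE-> /IH].
by case=> -> ->.
Qed.

Lemma landing_ge r s : r <= landing r s.
Proof. by elim: s r => //= a s IH r; apply: leq_trans (IH _); case: eqP. Qed.

Lemma size_insert w t : size (insert w t) = (size w).+1.
Proof. by rewrite /insert size_slide size_cat /= addnS -size_cat cat_take_drop. Qed.

Lemma insert_size (w : seq nat) : 0 \notin w -> insert w (size w) = rcons w 1.
Proof.
move=> w0; rewrite /insert /splice take_size drop_size slide_cat.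
by have [-> ->] := slide_id w0; rewrite /= cats1.
Qed.

Lemma new_row_size (w : seq nat) : 0 \notin w -> new_row w (size w) = 1.
Proof.
move=> w0; rewrite /new_row /splice take_size drop_size landing_cat.
by have [_ ->] := slide_id w0.
Qed.

Lemma splice_rcons w a t : t <= size w ->
  splice (rcons w a) t = rcons (splice w t) a.
Proof.
move=> le_t; rewrite /splice -cats1 takel_cat // drop_cat.
case: ltnP => [_|ge_t]; first by rewrite -cats1 -catA.
have -> : t = size w by apply/eqP; rewrite eqn_leq le_t.
by rewrite subnn drop0 drop_size -cats1 -catA.
Qed.

(** With new_row_rcons, this is Fomin's local rule: a largest entry in row a stays
    where it is unless the insertion into the smaller entries ends in its box, and
    then it is pushed to the next row.  The rule is symmetric in a and the row of
    the new box, and this is what identifies the two kinds of extension. *)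
Lemma insert_rcons w a t : t <= size w ->
  insert (rcons w a) t =
  rcons (insert w t) (if a == new_row w t then a.+1 else a).
Proof.
move=> le_t; rewrite /insert /new_row splice_rcons // -!cats1 slide_cat /=.
by case: eqP => [->|].
Qed.

Lemma new_row_rcons w a t : t <= size w ->
  new_row (rcons w a) t =
  if a == new_row w t then (new_row w t).+1 else new_row w t.
Proof.
by move=> le_t; rewrite /new_row splice_rcons // -!cats1 landing_cat.
Qed.

(** * The first row under insertion *)

Lemma count_slide_lt a r s : a < r -> count_mem a (slide r s) = count_mem a s.
Proof.
elim: s r => //= b s IH r lt_ar; case: eqP => [->|_] /=; rewrite IH //; lia.
Qed.

(** The first entry in row r leaves it, and from then on the slide only touches
    lower rows. *)
Lemma count_slide r s : count_mem r (slide r s) = (count_mem r s).-1.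
Proof.
elim: s => //= b s IH; case: (b =P r) => [_|/eqP/negbTE nbr] /=.
  by rewrite count_slide_lt // eqn_leq ltnn.
by rewrite nbr IH.
Qed.

Lemma count_insert_low (w : seq nat) t v : 0 \notin w -> v <= t -> t <= size w ->
  count_mem 1 (take v (insert w t)) = count_mem 1 (take v w).
Proof.
move=> w0 le_vt le_t; rewrite /insert take_slide /splice takel_cat; last first.
  by rewrite size_takel.
by rewrite take_takel // (slide_id (notin_take v w0)).1.
Qed.

Lemma count_insert_high (w : seq nat) t v : 0 \notin w -> t <= v -> t <= size w ->
  count_mem 1 (take v.+1 (insert w t)) =
  maxn (count_mem 1 (take v w)) (count_mem 1 (take t w)).+1.
Proof.
move=> w0 le_tv le_t; rewrite /insert take_slide /splice take_cat.
rewrite size_takel // ltnNge leqW //= subSn //= slide_cat.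
have [-> ->] := slide_id (notin_take t w0).
rewrite /= count_cat /= count_slide -{2}(subnKC le_tv) takeD count_cat.
move: (count_mem 1 (take t w)) (count_mem _ _) => a b; lia.
Qed.

(** * The number of rows under insertion *)

(** Entries that increase while their rows strictly increase form, read backwards,
    a decreasing subsequence of the row reading word of the tableau.  The bound
    a on the rows makes the recursion close. *)
Fixpoint longest (a : nat) (s : seq nat) : nat :=
  if s is c :: s' then
    if a <= c then maxn (longest a s') (longest c.+1 s').+1 else longest a s'
  else 0.

Lemma longest_anti a b s : a <= b -> longest b s <= longest a s.
Proof.
elim: s a b => //= c s IH a b le_ab; have := IH a b le_ab.
by case: (leqP b c); case: (leqP a c); lia.
Qed.

Lemma longest_step a s : longest a s <= (longest a.+1 s).+1.
Proof.
elim: s a => //= c s IH a; have := IH a.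
by case: (ltngtP a c) => [||->]; lia.
Qed.

(** The essential statement is the second one: an entry waiting for row r, which
    is smaller than everything in s, turns a chain with rows >= r into a chain
    with rows > r.  Unfolding longest at a letter c replaces the bound by
    c + 1, so that the bounds above r + 1 are needed in the induction.  There
    the slide can lengthen a chain, but only by bumping an entry from row b - 1
    to row b, and then the entries bumped before that one form in s a chain
    through the rows r, ..., b - 2; the term b - r - 1 is its length. *)
Lemma longest_slide r s :
  [/\ forall a, a <= r -> longest a (slide r s) = longest a s,
      longest r.+1 (slide r s) = longest r s,
      forall b, r < b -> longest b s <= longest b (slide r s) &
      forall b, r < b -> longest b (slide r s) + (b - r.+1) <=
        maxn (longest r s) (longest b s + (b - r.+1))].
Proof.
elim: s r => [|c s IH] r /=; first by split=> // b; lia.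
case: eqP => [->|/eqP ne_cr].
  have [A B C1 C2] := IH r.+1.
  split=> /=.
  - move=> a le_ar; rewrite leqW // le_ar A ?B //; lia.
  - rewrite ltnSn leqnn A ?B //; have := longest_step r s; lia.
  - move=> b lt_rb; rewrite (leqNgt b r) lt_rb /=.
    case: (ltngtP b r.+1) => [|lt|->]; [lia|exact: C1|].
    by rewrite A // B; lia.
  - move=> b lt_rb; rewrite leqnn (leqNgt b r) lt_rb /=.
    case: (ltngtP b r.+1) => [|lt|->]; first lia.
      by have := C2 b lt; have := @longest_anti r r.+1 s; lia.
    by rewrite A // B; have := longest_step r s; lia.
have [A B C1 C2] := IH r; split=> /=.
- move=> a le_ar; rewrite A //; case: leqP => // le_ac.
  case: (ltnP c r) => [lt_cr|le_rc]; first by rewrite A.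
  have lt_rc : r < c.+1 by lia.
  have := C1 _ lt_rc; have := C2 _ lt_rc; have := longest_anti s le_ar; lia.
- rewrite B; case: (ltngtP r c) => [lt_rc|lt_cr|]; [|by []|lia].
  have lt_rc' : r < c.+1 by lia.
  have := C1 _ lt_rc'; have := C2 _ lt_rc'; lia.
- move=> b lt_rb; have := C1 b lt_rb; case: (leqP b c) => // le_bc.
  have lt_rc : r < c.+1 by lia.
  have := C1 _ lt_rc; lia.
- move=> b lt_rb; have := C2 b lt_rb; case: (leqP b c) => [le_bc|lt_cb].
    have lt_rc : r < c.+1 by lia.
    have := C2 _ lt_rc; have -> : r <= c by lia.
    lia.
  by case: (leqP r c); lia.
Qed.

(** A letter 0 can only be the first letter of a strictly increasing chain. *)
Lemma longest_splice (w s : seq nat) : 0 \notin w -> 0 \notin s ->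
  longest 0 (w ++ 0 :: s) = maxn (longest 1 (w ++ s)) (longest 1 s).+1.
Proof.
have base x : 0 \notin x -> longest 0 x = longest 1 x.
  by elim: x => //= -[|c] x IH; rewrite inE //= => /IH->.
move=> + s0; elim: w => [|[|c] w IH] //=; first by rewrite base.
rewrite inE /= => w0; rewrite IH //.
have pre a : 0 < a -> longest a (w ++ 0 :: s) = longest a (w ++ s).
  elim: w {IH w0} a => [|d w IH] a a0 /=; first by rewrite leqNgt a0.
  by rewrite !IH.
by rewrite pre //; lia.
Qed.

(** Insertion at t acts on this statistic as appending the value t acts on the
    longest decreasing subsequence with values at least v: the new value can only
    be the last term. *)
Lemma longest_insert_low (w : seq nat) t v :
  0 \notin w -> v <= t -> t <= size w ->
  longest 1 (drop v (insert w t)) =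
  maxn (longest 1 (drop v w)) (longest 1 (drop t w)).+1.
Proof.
move=> w0 le_vt le_t; rewrite /insert drop_slide /splice.
rewrite takel_cat ?size_takel // take_takel //.
have [_ ->] := slide_id (notin_take v w0).
have [_ -> _ _] := longest_slide 0 (drop v (take t w ++ 0 :: drop t w)).
rewrite drop_cat size_takel //; have dw j := notin_drop j w0.
move: le_vt; rewrite leq_eqVlt => /predU1P[->|lt_vt].
  by rewrite ltnn subnn drop0 (@longest_splice [::]).
rewrite lt_vt longest_splice //; last first.
  exact/notin_drop/notin_take.
congr (maxn (longest 1 _) _).
by rewrite -{3}(cat_take_drop t w) drop_cat size_takel // lt_vt.
Qed.

Lemma longest_insert_high (w : seq nat) t v : 0 \notin w -> t <= v -> t <= size w ->
  longest 1 (drop v.+1 (insert w t)) = longest 1 (drop v w).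
Proof.
move=> w0 le_tv le_t; rewrite /insert drop_slide /splice take_cat drop_cat.
rewrite size_takel // ltnNge leqW //= subSn //= landing_cat.
have [_ ->] := slide_id (notin_take t w0).
have [A _ _ _] := longest_slide
  (landing 0 (0 :: take (v - t) (drop t w))) (drop (v - t) (drop t w)).
rewrite A; last exact: (landing_ge 1).
by rewrite drop_drop subnK.
Qed.

(** * Yamanouchi words and the inverse of insertion *)

(** For a = 0 the two counts coincide, so that addable letters are positive. *)
Definition addable (w : seq nat) (a : nat) : bool :=
  (a == 1) || (count_mem a w < count_mem a.-1 w).

(** Words grow at their right end, hence the recursion on the reversed word. *)
Fixpoint yamanouchi_rev (s : seq nat) : bool :=
  if s is a :: s' then addable s' a && yamanouchi_rev s' else true.

Definition yamanouchi (w : seq nat) : bool := yamanouchi_rev (rev w).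

Lemma addable_gt0 w a : addable w a -> 0 < a.
Proof. by case: a; rewrite /addable //= ltnn. Qed.

Lemma perm_addable w1 w2 a : perm_eq w1 w2 -> addable w1 a = addable w2 a.
Proof. by move=> /seq.permP e; rewrite /addable !e. Qed.

Lemma yamanouchi_rcons w a :
  yamanouchi (rcons w a) = addable w a && yamanouchi w.
Proof.
by rewrite /yamanouchi rev_rcons /= (perm_addable a (w2 := w)) // perm_rev.
Qed.

Lemma count_rcons a (w : seq nat) b :
  count_mem a (rcons w b) = count_mem a w + (b == a).
Proof. by rewrite -cats1 count_cat /= addn0. Qed.

Lemma yamanouchi_count w a : 0 < a -> yamanouchi w ->
  count_mem a.+1 w <= count_mem a w.
Proof.
move=> a0; elim/last_ind: w => // w b IH; rewrite yamanouchi_rcons.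
move=> /andP[+ /IH]; rewrite /addable !count_rcons.
case: eqP => [->|_] /=; first by case: a a0 {IH} => //= a _; case: eqP; lia.
have [->/=|nb] := eqVneq b a.+1; first by case: eqP; lia.
by lia.
Qed.

Lemma yamanouchi_notin0 w : yamanouchi w -> 0 \notin w.
Proof.
elim/last_ind: w => // w b IH; rewrite yamanouchi_rcons mem_rcons inE negb_or.
by case/andP=> /addable_gt0 + /IH->; case: b.
Qed.

(** By the local rule two boxes added in different rows do not interfere, and of
    two boxes meeting in row a the second goes to row a + 1, where it fits since
    row a + 1 was no longer than row a before row a grew. *)
Lemma insert_yamanouchi w t : yamanouchi w -> t <= size w ->
  [/\ yamanouchi (insert w t), addable w (new_row w t) &
      perm_eq (insert w t) (rcons w (new_row w t))].
Proof.
elim/last_ind: w => [|w a IH yw]; first by case: t.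
have w0 := yamanouchi_notin0 yw.
rewrite leq_eqVlt => /predU1P[->|].
  rewrite insert_size // new_row_size // yamanouchi_rcons yw /addable /=.
  by rewrite perm_refl.
rewrite size_rcons ltnS => le_t; move: yw; rewrite yamanouchi_rcons.
case/andP=> ad_a yw; have [yi ad_f pi] := IH yw le_t.
rewrite insert_rcons // new_row_rcons //.
have ct b := seq.permP pi (pred1 b); have cw b b0 := @yamanouchi_count w b b0 yw.
case: eqP => [ea|/eqP ne]; rewrite yamanouchi_rcons yi.
  rewrite -ea in ct pi ad_f *.
  have a0 := addable_gt0 ad_a.
  split.
  - rewrite andbT /addable /= !ct !count_rcons eqxx.
    by have := cw a a0; case: eqP; lia.
  - rewrite /addable /= !count_rcons eqxx.
    by have := cw a a0; case: eqP; lia.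
  - rewrite -cats1 -(cats1 _ a.+1) perm_cat2r //.
split.
- move: ad_a; rewrite andbT /addable !ct !count_rcons.
  by rewrite (eq_sym _ a) (negbTE ne); case: eqP => //=; lia.
- move: ad_f; rewrite /addable !count_rcons (negbTE ne).
  by case: eqP => //=; lia.
- rewrite -!cats1 -catA.
  apply: (perm_trans (y := (w ++ [:: new_row w t]) ++ [:: a])).
    by rewrite perm_cat2r cats1.
  by rewrite -catA perm_cat2l; apply/seq.permP => x /=; rewrite addnCA.
Qed.

(** The local rule can be run backwards: the last letter of the result equals
    the row of the new box exactly when a collision took place or the new entry
    was the largest one, and the last case is the one where this row is 1. *)
Lemma insert_inj w1 w2 t1 t2 : yamanouchi w1 -> yamanouchi w2 ->
  t1 <= size w1 -> t2 <= size w2 ->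
  insert w1 t1 = insert w2 t2 -> new_row w1 t1 = new_row w2 t2 ->
  w1 = w2 /\ t1 = t2.
Proof.
move=> + + + + E; have es : size w1 = size w2.
  by apply/eqP; rewrite -eqSS -(size_insert _ t1) -(size_insert _ t2) E.
elim/last_ind: w1 w2 es t1 t2 E => [|w1 a1 IH] w2; case/lastP: w2 => [|w2 a2] //.
- by move=> _ [|//] [|//].
- by rewrite size_rcons.
- by rewrite size_rcons.
move=> /eqP; rewrite !size_rcons eqSS => /eqP es t1 t2 E y1 y2.
have n1 := yamanouchi_notin0 y1; have n2 := yamanouchi_notin0 y2.
have y1' : yamanouchi w1 by move: y1; rewrite yamanouchi_rcons => /andP[].
have y2' : yamanouchi w2 by move: y2; rewrite yamanouchi_rcons => /andP[].
have pos w : yamanouchi w -> forall t, t <= size w -> 0 < new_row w t.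
  by move=> yw t /(insert_yamanouchi yw)[_ /addable_gt0].
have p1 := pos _ y1'; have p2 := pos _ y2'.
rewrite (leq_eqVlt t1) (leq_eqVlt t2) -!(size_rcons w1 a1) -!(size_rcons w2 a2).
move=> /predU1P[e1|]; last (rewrite size_rcons ltnS => l1).
  move=> /predU1P[e2|]; last (rewrite size_rcons ltnS => l2).
    by move: E; rewrite e1 e2 !insert_size // => /rcons_inj[->] _.
  move: E; rewrite e1 insert_size // new_row_size // insert_rcons //.
  rewrite new_row_rcons // => /rcons_inj[_ +].
  by have := p2 _ l2; case: eqP; lia.
move=> /predU1P[e2|]; last (rewrite size_rcons ltnS => l2).
  move: E; rewrite e2 insert_size // new_row_size // insert_rcons //.
  rewrite new_row_rcons // => /rcons_inj[_ +].
  by have := p1 _ l1; case: eqP; lia.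
move: E; rewrite !insert_rcons // !new_row_rcons // => /rcons_inj[E ea er].
have [] // := IH w2 es t1 t2 E y1' y2' l1 l2.
  by move: ea er; case: eqP; case: eqP; lia.
move=> -> et; split=> //; congr rcons.
rewrite -{}et in er ea *; have rr : new_row w1 t1 = new_row w2 t1.
  by move: ea er; case: eqP; case: eqP; lia.
by move: ea er; rewrite rr; case: eqP; case: eqP; lia.
Qed.

(** Reverse insertion, again by running the local rule backwards from the last
    letter.  The hypothesis on the counts says that row r ends with a removable
    box. *)
Lemma insert_surj p r : yamanouchi p -> 0 < r ->
  count_mem r.+1 p < count_mem r p ->
  exists w t, [/\ yamanouchi w, t <= size w, insert w t = p & new_row w t = r].
Proof.
elim/last_ind: p r => // p b IH r.
rewrite yamanouchi_rcons => /andP[ad_b yp] r0; rewrite !count_rcons => rem.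
have [eb|nb] := eqVneq b r.
  subst b; have [er|nr] := eqVneq r 1.
    exists p, (size p); have p0 := yamanouchi_notin0 yp.
    by rewrite er insert_size ?new_row_size.
  case: r => [|[|r]] // in r0 ad_b rem nr *.
  have [//||w [t [yw le_t ei en]]] := IH r.+1 yp.
    by move: ad_b; rewrite /addable.
  exists (rcons w r.+1), t; rewrite insert_rcons // new_row_rcons // en eqxx ei.
  rewrite size_rcons leqW // yamanouchi_rcons yw andbT; split=> //.
  by have [_ ad _] := insert_yamanouchi yw le_t; rewrite -en.
have [|w [t [yw le_t ei en]]] := IH r yp r0; first by lia.
exists (rcons w b), t; rewrite insert_rcons // new_row_rcons // en (negbTE nb) ei.
rewrite size_rcons leqW // yamanouchi_rcons yw andbT; split=> //.
have [_ _ /seq.permP pe] := insert_yamanouchi yw le_t.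
have b0 := addable_gt0 ad_b; move: rem ad_b; rewrite ei in pe.
rewrite /addable !pe !count_rcons en (eq_sym r b) (negbTE nb).
have [->|ne] := eqVneq b r.+1.
  by rewrite /= eqxx; lia.
have -> : (r == b.-1) = false by lia.
by rewrite !addn0.
Qed.

Lemma longest_bound s a m : all (fun c => c < m) s -> longest a s <= m - a.
Proof.
elim: s a => //= c s IH a /andP[lt_cm al]; have := IH a al; have := IH c.+1 al.
by case: (leqP a c); lia.
Qed.

Lemma longest_iota a m s : subseq (iota a m) s -> m <= longest a s.
Proof.
elim: s a m => [|c s IH] a [|m] //=; case: eqP => [<-|_] sub.
  by rewrite leqnn; have := IH _ _ sub; lia.
by have := IH a m.+1 sub; case: (leqP a c); lia.
Qed.

Lemma iota1S m : iota 1 m.+1 = rcons (iota 1 m) m.+1.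
Proof. by rewrite -[in LHS](addn1 m) iotaD cats1. Qed.

(** An entry can be put in row a only after one has been put in row a - 1. *)
Lemma yamanouchi_subseq w a : yamanouchi w -> a \in w -> subseq (iota 1 a) w.
Proof.
elim/last_ind: w a => // w b IH a; rewrite yamanouchi_rcons => /andP[ad yw].
rewrite mem_rcons inE => /predU1P[->|/(IH _ yw) sub]; last first.
  exact: subseq_trans sub (subseq_rcons _ _).
case: b ad => [|b] ad; first exact: sub0seq.
rewrite iota1S -!cats1 cat_subseq //; case: (posnP b) => [->|b0].
  exact: sub0seq.
move: ad; rewrite /addable eqSS (gtn_eqF b0) /= => lt.
by apply: IH => //; rewrite -has_pred1 has_count (leq_ltn_trans _ lt).
Qed.

(** For a word that comes from a full tableau, rather than a skew one, the longest
    chain counts the rows. *)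
Lemma longest_yamanouchi w l : 0 < l -> yamanouchi w ->
  (l <= longest 1 w) = has (leq l) w.
Proof.
move=> l0 yw; apply/idP/idP => [|/hasP[a aw le_la]]; last first.
  exact: leq_trans le_la (longest_iota (yamanouchi_subseq yw aw)).
apply: contraLR; rewrite -all_predC => al; rewrite -ltnNge.
have := @longest_bound w 1 l; rewrite (eq_all (a2 := predC (leq l))).
  by move=> /(_ al); lia.
by move=> c /=; rewrite ltnNge.
Qed.

(** * The Robinson-Schensted correspondence *)

Lemma right_extension_last n (s : 'S_n) t : right_extension s t ord_max = t.
Proof. exact: lift_perm_id. Qed.

Lemma right_extension_lift n (s : 'S_n) t i :
  right_extension s t (lift ord_max i) = lift t (s i).
Proof. exact: lift_perm_lift. Qed.

Lemma right_extension_inj n (s1 s2 : 'S_n) t :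
  right_extension s1 t = right_extension s2 t -> s1 = s2.
Proof.
move=> E; apply/permP => i; apply: (@lift_inj _ t).
by rewrite -!right_extension_lift E.
Qed.

Lemma right_extension_surj n (s : 'S_n.+1) :
  exists s', right_extension s' (s ord_max) = s.
Proof.
pose f i := odflt i (unlift (s ord_max) (s (lift ord_max i))).
have fE i : lift (s ord_max) (f i) = s (lift ord_max i).
  rewrite /f; case: unliftP => [j ->|/perm_inj E] //.
  by have := neq_lift ord_max i; rewrite E eqxx.
have f_inj : injective f.
  move=> i j E; apply/(@lift_inj _ ord_max)/(@perm_inj _ s).
  by rewrite -!fE E.
exists (perm f_inj); apply/permP => i; case: (unliftP ord_max i) => [j|] ->.
  by rewrite right_extension_lift permE fE.
by rewrite right_extension_last.
Qed.

(** Every permutation is obtained by appending values one at a time, so that all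
    facts about the correspondence are proved by following right extensions. *)
Lemma right_extension_ind (P : forall n, 'S_n -> Prop) :
  (forall s : 'S_0, P 0 s) ->
  (forall n (s : 'S_n) t, P n s -> P n.+1 (right_extension s t)) ->
  forall n (s : 'S_n), P n s.
Proof.
move=> P0 PS; elim=> // n IH s.
by have [s' <-] := right_extension_surj s; apply: PS.
Qed.

Definition initial_pattern n (s : 'S_n.+1) : 'S_n :=
  odflt 1%g [pick s' | right_extension s' (s ord_max) == s].

Lemma initial_patternK n (s : 'S_n) t :
  initial_pattern (right_extension s t) = s.
Proof.
rewrite /initial_pattern right_extension_last; case: pickP => [s' /eqP E|].
  exact: right_extension_inj E.
by move/(_ s); rewrite eqxx.
Qed.

Fixpoint rsk n : 'S_n -> seq nat * seq nat :=
  if n is n'.+1 return 'S_n -> seq nat * seq nat then fun s =>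
    let: (p, q) := rsk (initial_pattern s) in
    (insert p (s ord_max), rcons q (new_row p (s ord_max)))
  else fun=> ([::], [::]).

Lemma rsk_right n (s : 'S_n) t :
  rsk (right_extension s t) =
  (insert (rsk s).1 t, rcons (rsk s).2 (new_row (rsk s).1 t)).
Proof.
by rewrite /= initial_patternK right_extension_last; case: (rsk s).
Qed.

Lemma rsk_words n (s : 'S_n) :
  [/\ size (rsk s).1 = n, size (rsk s).2 = n, yamanouchi (rsk s).1,
      yamanouchi (rsk s).2 & perm_eq (rsk s).1 (rsk s).2].
Proof.
elim/right_extension_ind: n / s => // n s t [sp sq yp yq pq].
rewrite rsk_right /= size_insert size_rcons sp sq.
have [|yi ad pi] := @insert_yamanouchi _ t yp; first by rewrite sp -ltnS.
split=> //; first by rewrite yamanouchi_rcons yq -(perm_addable _ pq) ad.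
by rewrite (perm_trans pi) // -!cats1 perm_cat2r.
Qed.

Lemma rsk_inj n : injective (@rsk n).
Proof.
elim: n => [s1 s2 _|n IH s1 s2].
  by apply/permP => -[].
have [u1 <-] := right_extension_surj s1; have [u2 <-] := right_extension_surj s2.
move: (s1 _) (s2 _) => t1 t2; rewrite !rsk_right => -[Ei /rcons_inj[Eq Er]].
have [sp1 _ y1 _ _] := rsk_words u1; have [sp2 _ y2 _ _] := rsk_words u2.
have l1 : t1 <= size (rsk u1).1 by rewrite sp1 -ltnS.
have l2 : t2 <= size (rsk u2).1 by rewrite sp2 -ltnS.
have [Ep /val_inj->] := insert_inj y1 y2 l1 l2 Ei Er.
congr right_extension; apply: IH.
by rewrite [LHS]surjective_pairing Ep Eq -surjective_pairing.
Qed.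

Lemma rsk_surj n p q : yamanouchi p -> yamanouchi q -> perm_eq p q ->
  size p = n -> exists s : 'S_n, rsk s = (p, q).
Proof.
elim: n p q => [|n IH] p q yp yq pq sp.
  exists 1%g; move: sp (perm_size pq) => /=.
  by case: p {yp pq} => //; case: q {yq}.
case/lastP: q yq pq => [|q r] yq pq; first by rewrite (perm_size pq) in sp.
move: yq; rewrite yamanouchi_rcons => /andP[ad yq].
have r0 := addable_gt0 ad.
have [|w [t [yw le_t Ei Er]]] := insert_surj yp r0.
  rewrite !(seq.permP pq) !count_rcons eqxx; have := yamanouchi_count r0 yq.
  by rewrite (ltn_eqF (ltnSn r)); lia.
have [_ _ pw] := insert_yamanouchi yw le_t.
have wq : perm_eq w q.
  move: pw; rewrite Ei Er => pw.
  by rewrite -(perm_cat2r [:: r]) !cats1 -(permPl pw).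
have sw : size w = n by have := size_insert w t; rewrite Ei sp; case.
have [s Es] := IH w q yw yq wq sw.
have lt_t : t < n.+1 by rewrite ltnS -sw.
by exists (right_extension s (Ordinal lt_t)); rewrite rsk_right Es /= Ei Er.
Qed.

Lemma above_extension_max n (s : 'S_n) :
  above_extension s ord_max = right_extension s ord_max.
Proof. by []. Qed.

Lemma lift_max_lift n (a : 'I_n.+1) (b : 'I_n) :
  lift ord_max (lift a b) = lift (lift ord_max a) (lift ord_max b).
Proof.
by apply: val_inj; rewrite /= /bump; have := ltn_ord a; have := ltn_ord b; lia.
Qed.

(** This carries an extension from above through the induction along right
    extensions. *)
Lemma above_right_extension n (s : 'S_n) (t u : 'I_n.+1) :
  above_extension (right_extension s u) (lift ord_max t) =
  right_extension (above_extension s t) (lift ord_max u).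
Proof.
apply/permP => i; case: (unliftP ord_max i) => [j|] ->.
  rewrite right_extension_lift; case: (unliftP t j) => [j'|] ->.
    rewrite lift_max_lift !lift_perm_lift.
    exact: lift_max_lift.
  rewrite !lift_perm_id; apply: val_inj; rewrite /= /bump.
  by have := ltn_ord u; lia.
have E : ord_max = lift (lift ord_max t) ord_max :> 'I_n.+2.
  by apply: val_inj; rewrite /= /bump; have := ltn_ord t; lia.
rewrite right_extension_last {2}E.
by rewrite lift_perm_lift right_extension_last.
Qed.

(** Following right extensions, the new maximum is the largest entry of P
    as soon as it has been read, and the local rule tells how each later insertion
    moves it: this is the same scan as the insertion of t into Q. *)
Lemma rsk_above n (s : 'S_n) t :
  rsk (above_extension s t) =
  (rcons (rsk s).1 (new_row (rsk s).2 t), insert (rsk s).2 t).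
Proof.
have top m (u : 'S_m) : rsk (above_extension u ord_max) =
    (rcons (rsk u).1 (new_row (rsk u).2 m), insert (rsk u).2 m).
  have [sp sq yp yq _] := rsk_words u.
  have n1 := yamanouchi_notin0 yp; have n2 := yamanouchi_notin0 yq.
  have at_end w : 0 \notin w -> size w = m ->
      insert w m = rcons w 1 /\ new_row w m = 1.
    by move=> w0 <-; rewrite insert_size // new_row_size.
  rewrite above_extension_max rsk_right /=.
  by have [-> ->] := at_end _ n1 sp; have [-> ->] := at_end _ n2 sq.
elim/right_extension_ind: n / s t => [s t|n s u IH t].
  by rewrite (_ : t = ord_max) ?top //; apply: val_inj; case: t => -[].
case: (unliftP ord_max t) => [t'|] ->; last exact: top.
have [sp sq _ _ _] := rsk_words s.
have le_t : t' <= size (rsk s).2 by rewrite sq -ltnS.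
have le_u : u <= size (rsk s).1 by rewrite sp -ltnS.
rewrite above_right_extension !rsk_right IH /=.
rewrite /bump !(leqNgt n.+1) !ltn_ord !add0n.
rewrite !insert_rcons // !new_row_rcons //.
by rewrite (eq_sym (new_row _ u)); case: eqP => [->|].
Qed.

(** * Schensted's theorem *)

(** A common form of the increasing and decreasing patterns, with a condition P on
    the values that lets the induction along right extensions go through. *)
Definition has_chain (R : rel nat) (P : pred nat) (m n : nat) (s : 'S_n) :=
  exists A : {set 'I_n}, [/\ #|A| = m, {in A, forall i, P (s i)} &
    {in A &, forall i j : 'I_n, i < j -> R (s i) (s j)}].

Lemma has_chain_right R P m n (s : 'S_n) (t : 'I_n.+1) :
  (forall x y, R (bump t x) (bump t y) = R x y) ->
  has_chain R P m (right_extension s t) <->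
  has_chain R (fun x => P (bump t x)) m s \/
  0 < m /\ P t /\
    has_chain R (fun x => P (bump t x) && R (bump t x) t) m.-1 s.
Proof.
move=> RB; split.
  case=> A [cA PA RA]; pose B := [set i | lift ord_max i \in A].
  have cB : #|A :\ ord_max| = #|B|.
    rewrite -(card_imset _ (@lift_inj _ ord_max)); congr #|pred_of_set _|.
    apply/setP => i; rewrite !inE; case: (unliftP ord_max i) => [j|] ->.
      by rewrite eq_sym neq_lift mem_imset ?inE //; apply: lift_inj.
    rewrite eqxx; apply/esym/imsetP => -[j _ E].
    by have := neq_lift ord_max j; rewrite -E eqxx.
  have RB' : {in B &, forall i j : 'I_n, i < j -> R (s i) (s j)}.
    move=> i j; rewrite !inE => iA jA ij; rewrite -RB.
    have := RA _ _ iA jA; rewrite !right_extension_lift /=; apply.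
    by rewrite /bump; have := ltn_ord i; have := ltn_ord j; lia.
  have PB : {in B, forall i, P (bump t (s i))}.
    by move=> i; rewrite inE => /PA; rewrite right_extension_lift.
  move: cA; rewrite (cardsD1 ord_max) cB.
  case: (boolP (ord_max \in A)) => [mA|_] /= cA; last by left; exists B.
  right; split; first by rewrite -cA.
  split; first by have := PA _ mA; rewrite right_extension_last.
  exists B; split=> //; first by rewrite -cA.
  move=> i iB; rewrite PB //=; move: iB; rewrite inE => iA.
  have := RA _ _ iA mA; rewrite right_extension_lift right_extension_last.
  by apply; rewrite /= /bump; have := ltn_ord i; lia.
have im (B : {set 'I_n}) : {in B &, forall i j : 'I_n, i < j -> R (s i) (s j)} ->
    {in lift ord_max @: B &, forall i j : 'I_n.+1, i < j ->
      R (right_extension s t i) (right_extension s t j)}.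
  move=> RsB _ _ /imsetP[i iB ->] /imsetP[j jB ->] ij.
  rewrite !right_extension_lift /= RB; apply: RsB => //.
  by move: ij; rewrite /= /bump; have := ltn_ord i; have := ltn_ord j; lia.
case=> [[B [cB PB RsB]]|[m0 [Pt [B [cB PB RsB]]]]].
  exists (lift ord_max @: B); split; [|  |exact: im].
    by rewrite card_imset //; apply: lift_inj.
  by move=> _ /imsetP[i iB ->]; rewrite right_extension_lift; apply: PB.
exists (ord_max |: lift ord_max @: B); split.
- rewrite cardsU1 card_imset; last exact: lift_inj.
  rewrite cB; have -> : ord_max \notin lift ord_max @: B.
    by apply/imsetP => -[j _ E]; have := neq_lift ord_max j; rewrite -E eqxx.
  by rewrite add1n prednK.
- move=> i /setU1P[->|/imsetP[j jB ->]]; first by rewrite right_extension_last.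
  by rewrite right_extension_lift; have /andP[] := PB _ jB.
- move=> i j /setU1P[->|iB] /setU1P[->|jB]; first by rewrite ltnn.
  + by rewrite /= ltnNge -ltnS ltn_ord.
  + case/imsetP: iB => i' iB ->; rewrite right_extension_lift right_extension_last.
    by have /andP[] := PB _ iB.
  + by move=> ij; apply: (im B RsB).
Qed.

Lemma eq_has_chain R P1 P2 m n (s : 'S_n) : P1 =1 P2 ->
  has_chain R P1 m s <-> has_chain R P2 m s.
Proof.
by move=> E; split=> -[A [cA PA RA]]; exists A; split=> // i /PA; rewrite E.
Qed.

Lemma has_chain_empty R P m (s : 'S_0) : has_chain R P m s <-> m <= 0.
Proof.
split=> [[A [<- _ _]]|]; first by rewrite -[X in _ <= X]card_ord max_card.
rewrite leqn0 => /eqP->; exists set0.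
by rewrite cards0; split=> // i; rewrite inE.
Qed.

(** Schensted's theorem for increasing subsequences: the smallest last value of an
    increasing subsequence of length m is the m-th entry of the first row. *)
Lemma has_chain_inc v m n (s : 'S_n) : v <= n ->
  has_chain ltn (gtn v) m s <-> m <= count_mem 1 (take v (rsk s).1).
Proof.
elim/right_extension_ind: n / s v m => [s|n s t IH] v m.
  by rewrite leqn0 => /eqP->; exact: has_chain_empty.
move=> le_v; have [sp _ yp _ _] := rsk_words s.
have n0 := yamanouchi_notin0 yp.
have le_t : t <= n by rewrite -ltnS.
have le_ts : t <= size (rsk s).1 by rewrite sp.
have RB x y : ltn (bump t x) (bump t y) = ltn x y.
  by rewrite /= /bump; lia.
rewrite rsk_right (has_chain_right _ _ _ RB) /=.
case: (leqP v t) => [le_vt|lt_tv].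
  rewrite count_insert_low // -IH; last exact: leq_trans le_vt le_t.
  rewrite (@eq_has_chain _ _ (gtn v)); last by move=> x; rewrite /= /bump; lia.
  by split=> [[//|[_ [+ _]]]|]; [lia|left].
case: v lt_tv le_v => // v lt_tv le_v.
rewrite count_insert_high // leq_max.
rewrite (@eq_has_chain _ _ (gtn v)); last by move=> x; rewrite /= /bump; lia.
rewrite IH // (@eq_has_chain _ _ (gtn t)); last by move=> x; rewrite /= /bump; lia.
rewrite IH //; split=> [[->//|[m0 [_ le_m]]]|/orP[]]; [|by left|].
  by apply/orP; right; lia.
case: m => [|m] le_m; first by left.
by right.
Qed.

(** Schensted's theorem for decreasing subsequences, for every lower bound v on
    the values; the tableau restricted to the entries >= v is skew, which is why
    longest appears in place of the number of rows. *)
Lemma has_chain_dec v m n (s : 'S_n) : v <= n ->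
  has_chain gtn (leq v) m s <-> m <= longest 1 (drop v (rsk s).1).
Proof.
elim/right_extension_ind: n / s v m => [s|n s t IH] v m.
  by rewrite leqn0 => /eqP->; exact: has_chain_empty.
move=> le_v; have [sp _ yp _ _] := rsk_words s.
have n0 := yamanouchi_notin0 yp.
have le_t : t <= n by rewrite -ltnS.
have le_ts : t <= size (rsk s).1 by rewrite sp.
have RB x y : gtn (bump t x) (bump t y) = gtn x y.
  by rewrite /= /bump; lia.
rewrite rsk_right (has_chain_right _ _ _ RB) /=.
case: (leqP v t) => [le_vt|lt_tv].
  rewrite longest_insert_low // leq_max.
  rewrite (@eq_has_chain _ _ (leq v)); last by move=> x; rewrite /= /bump; lia.
  rewrite IH; last exact: leq_trans le_vt le_t.
  rewrite (@eq_has_chain _ _ (leq t)); last by move=> x; rewrite /= /bump; lia.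
  rewrite IH //; split=> [[->//|[m0 [_ le_m]]]|/orP[]]; [|by left|].
    by apply/orP; right; lia.
  by case: m => [|m] le_m; [left|right].
case: v lt_tv le_v => // v lt_tv le_v.
rewrite longest_insert_high // -IH //.
rewrite (@eq_has_chain _ _ (leq v)); last by move=> x; rewrite /= /bump; lia.
by split=> [[//|[_ [+ _]]]|]; [lia|left].
Qed.

Lemma contains_inc_rsk k n (s : 'S_n) :
  contains_inc k s = (k <= count_mem 1 (rsk s).1).
Proof.
have [sp _ _ _ _] := rsk_words s.
rewrite -[in RHS](take_size (rsk s).1) sp.
apply/existsP/idP => [[A]|/(has_chain_inc k s (leqnn n)).2[A]].
  case/andP=> /eqP cA /forall_inP h.
  apply/(has_chain_inc k s (leqnn n)); exists A; split=> //.
    by move=> i _ /=.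
  by move=> i j iA jA ij; have /forall_inP/(_ j jA)/implyP := h i iA; apply.
case=> cA _ h; exists A; rewrite cA eqxx /=.
by apply/forall_inP => i iA; apply/forall_inP => j jA; apply/implyP/h.
Qed.

Lemma contains_dec_rsk l n (s : 'S_n) :
  contains_dec l s = (l <= longest 1 (rsk s).1).
Proof.
rewrite -[in RHS](drop0 (rsk s).1).
apply/existsP/idP => [[A]|/(has_chain_dec l s (leq0n n)).2[A]].
  case/andP=> /eqP cA /forall_inP h.
  apply/(has_chain_dec l s (leq0n n)); exists A; split=> //.
  by move=> i j iA jA ij; have /forall_inP/(_ j jA)/implyP := h i iA; apply.
case=> cA _ h; exists A; rewrite cA eqxx /=.
by apply/forall_inP => i iA; apply/forall_inP => j jA; apply/implyP/h.
Qed.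

(** * Crucial tableaux *)

(** The shape does not fit in the rectangle with l - 1 rows and k - 1 columns. *)
Definition exceeds (k l : nat) (w : seq nat) : bool :=
  (k <= count_mem 1 w) || has (leq l) w.

Definition crucial (k l : nat) (w : seq nat) : bool :=
  ~~ exceeds k l w &&
  all (fun t => exceeds k l (insert w t)) (iota 0 (size w).+1).

Lemma perm_exceeds k l w1 w2 :
  perm_eq w1 w2 -> exceeds k l w1 = exceeds k l w2.
Proof. by move=> e; rewrite /exceeds (seq.permP e) (perm_has _ e). Qed.

Lemma exceeds_rcons k l w a :
  exceeds k l (rcons w a) =
  [|| exceeds k l w, k <= count_mem 1 w + (a == 1) | l <= a].
Proof.
rewrite /exceeds count_rcons has_rcons.
by case: (leqP l a); case: (has _ _); case: (a == 1);
  rewrite /= ?orbT ?orbF //; lia.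
Qed.

Lemma crucialP k l w :
  reflect (~~ exceeds k l w /\
           forall t, t <= size w -> exceeds k l (insert w t))
    (crucial k l w).
Proof.
apply: (iffP andP) => -[nw h]; split=> //.
  by move=> t le_t; apply: (allP h); rewrite mem_iota.
by apply/allP => t; rewrite mem_iota add0n ltnS; apply: h.
Qed.

Lemma contains_either_rsk k l n (s : 'S_n) : 0 < l ->
  contains_either k l s = exceeds k l (rsk s).1.
Proof.
move=> l0; have [_ _ yp _ _] := rsk_words s.
by rewrite /contains_either contains_inc_rsk contains_dec_rsk longest_yamanouchi.
Qed.

(** Right extensions test P and extensions from above test Q; whether the shape
    fits in the rectangle can be read on either tableau. *)
Lemma top_right_crucial_rsk k l n (s : 'S_n) : 0 < l ->
  top_right_crucial k l s = crucial k l (rsk s).1 && crucial k l (rsk s).2.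
Proof.
move=> l0; have [sp sq yp yq pq] := rsk_words s.
rewrite /top_right_crucial andbA -negb_or -/(contains_either k l s).
rewrite contains_either_rsk // /crucial -(perm_exceeds _ _ pq) andbACA andbb sp sq.
have ordE (f : nat -> bool) : [forall t : 'I_n.+1, f t] = all f (iota 0 n.+1).
  apply/forallP/allP => [h t|h t]; last by apply: h; rewrite mem_iota /=.
  by rewrite mem_iota add0n => lt_t; apply: (h (Ordinal lt_t)).
rewrite -!ordE; congr [&& _, _ & _]; apply: eq_forallb => t.
  by rewrite contains_either_rsk // rsk_right.
have le_t : t <= size (rsk s).2 by rewrite sq -ltnS.
have [_ _ pi] := insert_yamanouchi yq le_t.
rewrite contains_either_rsk // rsk_above /= (perm_exceeds _ _ pi).
by apply: perm_exceeds; rewrite -!cats1 perm_cat2r.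
Qed.

(** Appending a new largest value adds a box to the first row, which must therefore
    be full. *)
Lemma crucial_first_row k l w : 1 < l -> yamanouchi w -> crucial k l w ->
  (count_mem 1 w).+1 = k.
Proof.
move=> l1 yw /crucialP[nw /(_ _ (leqnn _))].
rewrite insert_size ?yamanouchi_notin0 // exceeds_rcons (negbTE nw) /=.
rewrite (leqNgt l) l1 orbF addn1 => ge_k.
move: nw; rewrite negb_or -ltnNge => /andP[lt_k _].
by apply/eqP; rewrite eqn_leq lt_k.
Qed.

(** By the local rule the insertion of an older value into rcons w c contains its
    insertion into w, which leaves the rectangle; a new largest value is inserted
    in the first row, which is full. *)
Lemma crucial_rcons k l w c : yamanouchi w -> addable w c -> 1 < c < l ->
  crucial k l w -> crucial k l (rcons w c).
Proof.
move=> yw ad /andP[c1 cl] cw; have l1 := ltn_trans c1 cl.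
have k1 := crucial_first_row l1 yw cw; case/crucialP: cw => nw h.
apply/crucialP; split.
  rewrite exceeds_rcons (negbTE nw) /= (gtn_eqF c1) addn0 -k1 ltnn /=.
  by rewrite -ltnNge.
move=> t; rewrite size_rcons leq_eqVlt => /predU1P[->|le_t].
  rewrite -(size_rcons w c) insert_size; last first.
    by apply: yamanouchi_notin0; rewrite yamanouchi_rcons ad.
  by rewrite exceeds_rcons count_rcons -k1 addn1 ltnS leq_addr orbT.
by rewrite insert_rcons // exceeds_rcons h.
Qed.

Lemma count_rows d m w : (forall c, 0 < c <= m -> d <= count_mem c w) ->
  d * m <= count (fun x => 0 < x <= m) w.
Proof.
elim: m => [|m IH] h; first by rewrite muln0.
have {}IH : d * m <= count (fun x => 0 < x <= m) w.
  by apply: IH => c hc; apply: h; lia.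
rewrite mulnS addnC.
rewrite (@eq_count _ _ (predU (fun x => 0 < x <= m) (pred1 m.+1))); last first.
  by move=> x /=; lia.
have := count_predUI (fun x => 0 < x <= m) (pred1 m.+1) w.
rewrite (@eq_count _ (predI _ _) pred0); last by move=> x /=; lia.
rewrite count_pred0 addn0 => ->.
by apply: leq_add => //; apply: h; rewrite ltnS leqnn.
Qed.

(** The topmost row that is not full can receive a box, since the row above it is
    full; it is not the first row, by crucial_first_row. *)
Lemma exists_addable k l w : 1 < l -> yamanouchi w -> crucial k l w ->
  size w < (k - 1) * (l - 1) -> exists2 c, addable w c & 1 < c < l.
Proof.
move=> l1 yw cw lt_w; have k1 := crucial_first_row l1 yw cw.
have ex : exists c, (0 < c < l) && (count_mem c w < k - 1).
  have [/hasP[c]|/hasPn no_c] :=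
      boolP (has (fun c => count_mem c w < k - 1) (iota 1 (l - 1))).
    by rewrite mem_iota => hc lt_c; exists c; rewrite lt_c andbT; lia.
  move: lt_w; rewrite ltnNge => /negP[].
  apply: leq_trans (count_size (fun x => 0 < x <= l - 1) w).
  apply: count_rows => c hc; rewrite leqNgt; apply: no_c.
  by rewrite mem_iota; lia.
have [c /andP[/andP[c0 cl] lt_c] min_c] := ex_minnP ex.
have c1 : 1 < c.
  rewrite ltn_neqAle c0 andbT; apply/eqP => e1.
  by move: lt_c; rewrite -e1 -k1 subn1 ltnn.
exists c; last by rewrite c1.
rewrite /addable (gtn_eqF c1) /= (leq_trans lt_c) // leqNgt.
apply/negP => lt_c'; have := min_c c.-1; rewrite lt_c' andbT.
by have -> : 0 < c.-1 < l; lia.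
Qed.

(** * A crucial tableau that is not an enlargement of one *)

Lemma landing_iota_ge a m r : a <= r -> a + m <= landing r (iota a m).
Proof.
elim: m a r => [|m IH] a r le_ar /=; first by rewrite addn0.
by rewrite -addSnnS; apply: IH; case: eqP => //; lia.
Qed.

Lemma landing_iota a m : landing a (iota a m) = a + m.
Proof. by elim: m a => [|m IH] a /=; rewrite ?addn0 // eqxx IH addSnnS. Qed.

(** The tableau with rows of length d, filled one row after the other. *)
Definition rows_word (d m : nat) : seq nat := mkseq (fun j => (j %/ d).+1) m.

Lemma count_rows_word d m r : 0 < d ->
  count_mem r.+1 (rows_word d m) = minn d (m - r * d).
Proof.
move=> d0; elim: m => [|m IH]; first by rewrite sub0n minn0.
rewrite /rows_word mkseqS count_rcons -/(rows_word d m) IH eqSS.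
have := divn_eq m d; have := ltn_pmod m d0.
case: (ltngtP (m %/ d) r) => [lt|gt|->]; nia.
Qed.

Lemma rows_word_yamanouchi d m : 0 < d -> yamanouchi (rows_word d m).
Proof.
move=> d0; elim: m => // m IH.
rewrite /rows_word mkseqS yamanouchi_rcons -/(rows_word d m) IH andbT /addable.
case: (posnP (m %/ d)) => [->//|r0]; apply/orP; right.
rewrite -(prednK r0) /= !count_rows_word // (prednK r0).
have := divn_eq m d; have := ltn_pmod m d0; nia.
Qed.

(** One further box at the end of each of the first r rows, filled downwards. *)
Definition hooked_word (d r m : nat) : seq nat := rows_word d m ++ iota 1 r.

Lemma hooked_word_yamanouchi d r m : 0 < d -> yamanouchi (hooked_word d r m).
Proof.
move=> d0; have yu := rows_word_yamanouchi m d0.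
rewrite /hooked_word; elim: r => [|r IH]; first by rewrite cats0.
rewrite iota1S -rcons_cat yamanouchi_rcons IH andbT /addable.
case: r {IH} => [//|r]; apply/orP; right; rewrite !count_cat -pred_Sn.
have := yamanouchi_count (ltn0Sn r) yu.
have -> : count_mem r.+2 (iota 1 r.+1) = 0.
  by apply/count_memPn; rewrite mem_iota; lia.
have -> : count_mem r.+1 (iota 1 r.+1) = 1.
  by rewrite count_uniq_mem ?iota_uniq // mem_iota; lia.
by lia.
Qed.

Lemma count1_hooked_word d r m : 0 < d -> d <= m ->
  count_mem 1 (hooked_word d r.+1 m) = d.+1.
Proof.
move=> d0 le_dm; rewrite count_cat count_rows_word // mul0n subn0.
rewrite (minn_idPl le_dm) count_uniq_mem ?iota_uniq // mem_iota /=; lia.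
Qed.

Lemma hooked_word_bound d r m l : 0 < d -> m <= d * l -> r <= l ->
  ~~ has (leq l.+1) (hooked_word d r m).
Proof.
move=> d0 le_m le_r; rewrite has_cat negb_or; apply/andP; split; apply/hasPn.
  move=> _ /mapP[j + ->]; rewrite mem_iota -ltnNge ltnS => /andP[_ lt_j].
  by rewrite ltn_divLR // mulnC; lia.
by move=> c; rewrite mem_iota; lia.
Qed.

Lemma exceeds_insert k l w t : yamanouchi w -> t <= size w ->
  exceeds k l (insert w t) = exceeds k l (rcons w (new_row w t)).
Proof. by move=> yw le_t; have [_ _ /perm_exceeds] := insert_yamanouchi yw le_t. Qed.

(** If the inserted value lies below the l largest entries, then the entry that
    is waiting for some row i when the scan reaches them bumps the ends of the
    rows i, ..., l, and row l + 1 is created.  Otherwise no larger entry is in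
    the first row, which is full and becomes too long. *)
Lemma hooked_word_crucial d l m : 0 < d -> 0 < l -> d <= m -> m <= d * l ->
  crucial d.+2 l.+1 (hooked_word d l m).
Proof.
move=> d0; case: l => // l _ le_dm le_m.
have yw := hooked_word_yamanouchi l.+1 m d0.
have yu := yamanouchi_notin0 (rows_word_yamanouchi m d0).
have nw : ~~ exceeds d.+2 l.+2 (hooked_word d l.+1 m).
  by rewrite negb_or count1_hooked_word // ltnn hooked_word_bound.
apply/crucialP; split=> // t le_t.
rewrite exceeds_insert // exceeds_rcons (negbTE nw) count1_hooked_word //=.
have size_u : size (rows_word d m) = m by rewrite size_mkseq.
rewrite /new_row /splice landing_cat (slide_id (notin_take t _)).2; last first.
  exact: yamanouchi_notin0.
rewrite /= /hooked_word drop_cat size_u; case: (ltnP t m) => [lt_t|le_mt].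
  rewrite landing_cat; apply/orP; right.
  exact: (@landing_iota_ge 1 l.+1 _ (landing_ge _ _)).
case: (posnP (t - m)) => [->|tm].
  by rewrite drop0 landing_iota leqnn orbT.
rewrite (slide_id _).2 ?addn1 ?leqnn // -(prednK tm) /=.
by apply: notin_drop; rewrite mem_iota.
Qed.

(** With one row end missing, a value placed just below the largest l entries bumps
    exactly these and lands in row l + 1, which is still allowed. *)
Lemma hooked_word_not_crucial d l m : 0 < d -> 0 < l -> d <= m -> m <= d * l.+1 ->
  ~~ crucial d.+2 l.+2 (hooked_word d l m).
Proof.
move=> d0; case: l => // l _ le_dm le_m; apply/crucialP => -[nw /(_ m)].
have yw := hooked_word_yamanouchi l.+1 m d0.
have yu := yamanouchi_notin0 (rows_word_yamanouchi m d0).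
have size_u : size (rows_word d m) = m by rewrite size_mkseq.
rewrite /hooked_word size_cat size_u leq_addr => /(_ isT).
rewrite exceeds_insert //; last by rewrite size_cat size_u leq_addr.
rewrite exceeds_rcons (negbTE nw) count1_hooked_word //=.
rewrite /new_row /splice landing_cat (slide_id (notin_take m _)).2; last first.
  exact: yamanouchi_notin0.
rewrite drop_cat size_u ltnn subnn drop0.
rewrite -[landing 0 _]/(landing 1 (iota 1 l.+1)) landing_iota.
by rewrite add1n eqSS addn0 ltnn ltnn.
Qed.

(** * Counting *)

Theorem theorem30 (k l n : nat) (hk : 0 < k) (hl : 0 < l) (hn : 0 < n)
    (hlow : k + l - 3 <= n) (hhigh : n < (k - 1) * (l - 1)) :
  num_top_right_crucial n k l < num_top_right_crucial n.+1 k l.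
Proof.
have [d ek] : exists d, k = d.+3.
  exists (k - 3); case: k hk hlow hhigh => [|[|[|k]]]; lia.
have [r el] : exists r, l = r.+3.
  exists (l - 3); case: l hl hlow hhigh => [|[|[|l]]]; lia.
(* The l - 1 = r.+2 largest entries are the row ends; m counts the others. *)
pose m := n.+1 - r.+2.
have le_dm : d.+1 <= m by lia.
have le_md : m <= d.+1 * r.+2 by rewrite /m; nia.
pose W := hooked_word d.+1 r.+2 m.
have yW : yamanouchi W by apply: hooked_word_yamanouchi.
have sW : size W = n.+1 by rewrite size_cat size_mkseq size_iota; lia.
have [u Eu] := rsk_surj yW yW (perm_refl W) sW.
pose T j := [set s : 'S_j | top_right_crucial k l s].
have uT : u \in T n.+1.
  by rewrite inE top_right_crucial_rsk // Eu andbb ek el hooked_word_crucial.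
(* restrict s' deletes the largest entry of both tableaux; every
   top-right-crucial s of length n is reached from some s' other than u. *)
pose restrict (s' : 'S_n.+1) :=
  [pick s : 'S_n | rsk s == (take n (rsk s').1, take n (rsk s').2)].
have sub : Some @: T n \subset restrict @: (T n.+1 :\ u).
  apply/subsetP => _ /imsetP[s + ->]; rewrite inE top_right_crucial_rsk //.
  have [sp sq yp yq pq] := rsk_words s; case/andP=> cp cq.
  have [||c ad c_bd] := exists_addable _ yp cp; [lia|by rewrite sp|].
  have adq : addable (rsk s).2 c by rewrite -(perm_addable _ pq).
  have [||||s' Es'] := @rsk_surj n.+1 (rcons (rsk s).1 c) (rcons (rsk s).2 c).
  - by rewrite yamanouchi_rcons ad.
  - by rewrite yamanouchi_rcons adq.
  - by rewrite -!cats1 perm_cat2r.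
  - by rewrite size_rcons sp.
  have take_rcons (w : seq nat) : size w = n -> take n (rcons w c) = w.
    by move=> <-; rewrite -cats1 take_size_cat.
  apply/imsetP; exists s'.
    rewrite !inE top_right_crucial_rsk // Es' !crucial_rcons // !andbT.
    apply/eqP => Es; move: Es' cp; rewrite Es Eu => -[EW _].
    apply/negP; rewrite -[(rsk s).1]take_rcons // -EW ek el.
    have -> : take n W = hooked_word d.+1 r.+1 m.
      rewrite /W /hooked_word take_cat size_mkseq take_iota ifF; last by lia.
      by congr (_ ++ iota _ _); lia.
    by apply: hooked_word_not_crucial.
  rewrite /restrict; case: pickP => [s1 /eqP|/(_ s)]; rewrite Es' !take_rcons //.
    by rewrite -surjective_pairing => /rsk_inj->.
  by rewrite -surjective_pairing eqxx.
rewrite /num_top_right_crucial -/(T n) -/(T n.+1).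
rewrite -(card_imset _ (@Some_inj _)) (leq_ltn_trans (subset_leq_card sub)) //.
apply: leq_ltn_trans (leq_imset_card _ _) _.
by rewrite [#|T n.+1|](cardsD1 u) uT.
Qed.
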